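(* Let $k\ge 1$ be a constant and let $n \leq m \leq n^k$. Consider the RBB process with $m$ balls and $n$ bins, started from an arbitrary configuration. Let $c_r := 16 \cdot 384^2 \cdot 744^2$. There exists a constant $C > 0$ such that, for any round $t \geq c_r \cdot \frac{m^2}{n}$, \[ \Pr\Big[\bigcap_{s \in [t, t + m^2]} \Big\{ \max_{i \in [n]} x_i^s \leq C \cdot \frac{m}{n} \cdot \log n \Big\}\Big] \geq 1 - n^{-2k}. \]
   Context: Repeated balls-into-bins (RBB) process: there are $n$ bins and $m$ balls, initially distributed arbitrarily; $x^t=(x_1^t,\dots,x_n^t)$ denotes the load vector after $t$ rounds, so $\sum_i x_i^t = m$ for all $t$. In each round $t=0,1,2,\ldots$, let $\kappa^t$ be the number of non-empty bins in $x^t$; one ball is removed from each non-empty bin and each of these $\kappa^t$ balls is placed into a bin chosen independently and uniformly at random from $[n]$, i.e. $x_i^{t+1} = x_i^t - \mathbf{1}_{x_i^t>0} + \sum_{j=1}^{\kappa^t}\mathbf{1}_{z_j^t=i}$ with $z_j^t$ independent uniform in $[n]$. *)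

(* Defs.v *)
From HB Require Import structures.
From mathcomp Require Import all_boot all_order all_algebra.
From mathcomp Require Import all_classical all_reals all_analysis.

Set Implicit Arguments.
Unset Strict Implicit.
Unset Printing Implicit Defensive.

Import Order.TTheory GRing.Theory Num.Theory.
Local Open Scope classical_set_scope.
Local Open Scope ring_scope.

(* Random variables with values in the finite set 'I_n, which carries the
   discrete sigma-algebra: every preimage is an event. *)
Definition discrete_rv d (T : measurableType d) (n : nat) (X : T -> 'I_n) :=
  forall B : set 'I_n, measurable (X @^-1` B).

Definition uniform_rv (R : realType) d (T : measurableType d)
    (P : probability T R) (n : nat) (X : T -> 'I_n) :=
  forall b : 'I_n, P (X @^-1` [set b]) = (n%:R^-1)%:E.

Definition mutually_independent (R : realType) d (T : measurableType d)
    (P : probability T R) (n : nat) (I : eqType) (X : I -> T -> 'I_n) :=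
  forall (J : seq I) (B : I -> set 'I_n), uniq J ->
    P (\bigcap_(i in [set` J]) (X i @^-1` B i)) =
    (\prod_(i <- J) P (X i @^-1` B i))%E.

(* z t j is the bin chosen in round t by the j-th ball removed.  At most n
   balls are removed per round, so j ranges over 'I_n; in round t only the
   choices z t j with j < kappa^t are used. *)
Definition iid_uniform_choices (R : realType) d (T : measurableType d)
    (P : probability T R) (n : nat) (z : nat -> 'I_n -> T -> 'I_n) :=
  [/\ forall t j, discrete_rv (z t j),
      forall t j, uniform_rv P (z t j)
    & mutually_independent P (fun tj : nat * 'I_n => z tj.1 tj.2)].

Section RepeatedBallsIntoBins.
Variable n : nat.

Definition loads := {ffun 'I_n -> nat}.

Implicit Types (x : loads) (c : 'I_n -> 'I_n).

Definition nonempty_bins x : nat := #|[pred i : 'I_n | (0 < x i)%N]|.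

Definition max_load x : nat := \max_(i < n) x i.

Definition rbb_step x c : loads :=
  [ffun i => (x i - (0 < x i)%N +
              \sum_(j < n | (j < nonempty_bins x)%N) (c j == i))%N].

Fixpoint rbb (T : Type) (z : nat -> 'I_n -> T -> 'I_n) x (t : nat) (w : T)
    : loads :=
  if t is t'.+1 then rbb_step (rbb z x t' w) (fun j => z t' j w) else x.

End RepeatedBallsIntoBins.

(* Main.v *)
Require Import Defs.
From HB Require Import structures.
From mathcomp Require Import all_boot all_order all_algebra.
From mathcomp Require Import all_classical all_reals all_analysis.
From mathcomp Require Import ring lra zify.

(* Write B = m/n and let f be the fraction of empty bins.  A bin of load x > 0
   has drift -f, so with eta of order 1/B the sum Phi of (1+eta)^(x_i) shrinks by
   a factor 1 - eta f + O(eta^2) per round; but f may vanish in some rounds.  To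
   see that f is of order 1/B on average, use psi, the mean of (1-p)^(x_i) with
   p = 1/(2B).  It lies in [1/2, 1], and the variance of the arrivals gives
   E[psi'] >= psi + p^2/16 - 2 p f, so psi can only fail to grow when f is large.
   Since psi is bounded, the product Phi * (A - psi) with a large constant A is
   comparable to Phi, and it contracts by 1 - Omega(p^2) in every round, up to an
   additive O(eta n) from the empty bins.  Hence E[Phi] = O(m) once t is at
   least a constant times m^2/n, whatever the initial loads; Markov's inequality
   and a union bound conclude. *)

Set Implicit Arguments.
Unset Strict Implicit.
Unset Printing Implicit Defensive.

Import Order.TTheory GRing.Theory Num.Theory.
Local Open Scope classical_set_scope.
Local Open Scope ring_scope.

(** * Elementary inequalities for powers close to 1 *)

Section RealInequalities.
Variable R : realType.
Implicit Types (u p eta : R) (n k : nat).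

Lemma bernoulli_ge u n : 0 <= u <= 1 -> 1 - n%:R * u <= (1 - u) ^+ n.
Proof.
move=> /andP[u0 u1]; elim: n => [|n IH]; first by rewrite expr0 mul0r subr0.
rewrite exprS -natr1.
have := ler_wpM2l (_ : 0 <= 1 - u) IH; rewrite subr_ge0 => /(_ u1).
apply: le_trans; have : 0 <= n%:R * (u * u) by rewrite !mulr_ge0.
lra.
Qed.

(* Bernoulli's inequality on the two halves of the product keeps a second-order
   term, which is the variance of the number of balls received by a bin. *)
Lemma bernoulli2_ge p n : (1 < n)%N -> 0 <= p <= 1 ->
  1 - p + p ^+ 2 / 8 <= (1 - p / n%:R) ^+ n.
Proof.
move=> n1 /andP[p0 p1]; have n0 : 0 < n%:R :> R by rewrite ltr0n; lia.
set u := p / n%:R.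
have up : u * n%:R = p by rewrite divfK ?gt_eqF.
have u0 : 0 <= u by rewrite divr_ge0 // ltW.
have u1 : u <= 1.
  by rewrite ler_pdivrMr // mul1r (le_trans p1) // ler1n; lia.
pose h := (n./2)%N; pose g := (n - h)%N.
have nE : (n = h + g)%N by rewrite /g /h; lia.
(* The cross term of [(1 - h u) (1 - g u)] is [h g u^2], at least [p^2 / 8] by this bound, which
   relies on [n > 1]. *)
have hg : (n ^ 2 <= 8 * (h * g))%N by rewrite /g /h; nia.
have hgR : n%:R ^+ 2 <= 8 * (h%:R * g%:R) :> R.
  by rewrite -natrX -!natrM ler_nat.
have nR : n%:R = h%:R + g%:R :> R by rewrite nE natrD.
have Bh := @bernoulli_ge u h; have Bg := @bernoulli_ge u g.
rewrite u0 u1 in Bh Bg; have {}Bh := Bh isT; have {}Bg := Bg isT.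
have gp : 0 <= 1 - g%:R * u.
  have : 0 <= h%:R * u by rewrite mulr_ge0.
  by move: up p1; rewrite nR; nra.
have hp : 0 <= 1 - h%:R * u.
  have : 0 <= g%:R * u by rewrite mulr_ge0.
  by move: up p1; rewrite nR; nra.
rewrite nE exprD; apply: le_trans (ler_pM hp gp Bh Bg).
have -> : p ^+ 2 = u ^+ 2 * n%:R ^+ 2 by rewrite -up exprMn.
have := ler_wpM2l (sqr_ge0 u) hgR.
rewrite -[X in 1 - X]up nR; nra.
Qed.

(** [(1 + u)^k (1 - u)^k <= 1], and Bernoulli's inequality bounds the second factor from below. *)
Lemma pow_le_inv u k : 0 <= u -> k%:R * u < 1 ->
  (1 + u) ^+ k <= (1 - k%:R * u)^-1.
Proof.
case: k => [|k] u0 ku; first by rewrite mul0r subr0 invr1 expr0.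
have u1 : u <= 1.
  apply: le_trans (ltW ku); rewrite -natr1 mulrDl mul1r lerDr.
  by rewrite mulr_ge0.
rewrite -[leRHS]mul1r ler_pdivlMr; last by rewrite subr_gt0.
have B : 1 - k.+1%:R * u <= (1 - u) ^+ k.+1 by rewrite bernoulli_ge ?u0.
apply: le_trans (ler_wpM2l _ B) _; first by rewrite exprn_ge0 ?addr_ge0.
rewrite -exprMn; apply: exprn_ile1; nra.
Qed.

(** With [k] non-empty bins, the left side is the growth caused by arrivals. The factor [1 + eta] is
    split off because it cancels against the ball removed from each non-empty bin; what remains has
    first-order term [- eta f], with [f] the fraction of empty bins. *)
Lemma growth_factor_le eta n k : (k <= n)%N -> (0 < n)%N -> 0 <= eta <= 1/2 ->
  (1 + eta / n%:R) ^+ k <=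
  (1 + eta) * (1 - eta * (1 - k%:R / n%:R) + 3 * eta ^+ 2).
Proof.
move=> kn n0 /andP[e0 e1]; have nR0 : 0 < n%:R :> R by rewrite ltr0n.
set g := k%:R / n%:R.
have g0 : 0 <= g by rewrite divr_ge0.
have g1 : g <= 1 by rewrite ler_pdivrMr // mul1r ler_nat.
have kg : k%:R * (eta / n%:R) = eta * g by rewrite /g; field; rewrite gt_eqF.
apply: le_trans (pow_le_inv _ _) _; first by rewrite divr_ge0 // ltW.
  by rewrite kg; nra.
have D : 0 < 1 - eta * g by nra.
rewrite kg -[leLHS]mul1r ler_pdivrMr //.
have f0 : 0 <= 1 - g by lra.
set f := 1 - g in f0 *; have -> : g = 1 - f by rewrite /f; lra.
have f1 : f <= 1 by rewrite /f; lra.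
clearbody f; clear -e0 e1 f0 f1.
(* It remains to see that this lower bound, times [1 - eta f + 3 eta^2], is at least 1: the
   first-order terms cancel and [3 eta^2] covers the rest. *)
have H : 1 + eta * f - eta ^+ 2 <= (1 + eta) * (1 - eta * (1 - f)).
  by have : 0 <= eta ^+ 2 * f; [rewrite mulr_ge0 ?sqr_ge0|lra].
have P : 0 <= 1 - eta * f + 3 * eta ^+ 2.
  have : eta * f <= 1/2 * 1 by rewrite ler_pM.
  by have := sqr_ge0 eta; lra.
have H2 := ler_wpM2l P H.
rewrite mulrAC mulrC; apply: le_trans H2.
have -> : (1 - eta * f + 3 * eta ^+ 2) * (1 + eta * f - eta ^+ 2) =
 1 + eta ^+ 2 * (2 - f ^+ 2 + 4 * (eta * f) - 3 * eta ^+ 2) by ring.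
rewrite lerDl mulr_ge0 ?sqr_ge0 //.
have : 0 <= eta * f by rewrite mulr_ge0.
nra.
Qed.

(** Contribution of a single ball: a loss of [2 eta p / n] on the product of the two marginal
    factors brings it below the joint factor, even for two equal bins, where that factor has the
    extra term [- eta p / n]. *)
Lemma decorrelation_base p eta n : (0 < n)%N ->
  0 <= p <= 1/2 -> 0 <= eta <= 1/2 ->
  0 <= (1 + eta / n%:R) * (1 - p / n%:R) * (1 - 2 * (eta * p) / n%:R)
    <= 1 + (eta - p - eta * p) / n%:R.
Proof.
move=> n0 /andP[p0 p1] /andP[e0 e1]; have n1 : 0 < n%:R :> R by rewrite ltr0n.
have v0 : 0 < n%:R^-1 :> R by rewrite invr_gt0.
have v1 : n%:R^-1 <= 1 :> R by rewrite invf_le1 // ler1n.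
set v := n%:R^-1 in v0 v1 *.
have ep : 0 <= eta * p by rewrite mulr_ge0.
have ep1 : eta * p <= 1/2 by nra.
have H : 2 * (eta * p) * v <= 1 by nra.
have ev : 0 <= eta * v by rewrite mulr_ge0 // ltW.
have pv : 0 <= p * v by rewrite mulr_ge0 // ltW.
have pv2 : p * v <= 1/2 by nra.
apply/andP; split; first by rewrite !mulr_ge0; lra.
have -> : (1 + eta * v) * (1 - p * v) * (1 - 2 * (eta * p) * v) =
  1 + (eta - p - eta * p) * v - (eta * p * v) *
  (1 + 2 * eta * v - 2 * (p * v) + v - 2 * (eta * p * v * v)) by ring.
have : 0 <= (eta * p * v) *
  (1 + 2 * eta * v - 2 * (p * v) + v - 2 * (eta * p * v * v)).
  by rewrite !mulr_ge0 // ?ltW //; nra.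
lra.
Qed.

End RealInequalities.

(** * One round as an averaging operator, and generating functions of the loads *)

Section Step.
Variables (R : realType) (n : nat).
Hypothesis n_gt0 : (0 < n)%N.
Implicit Types (x : loads n) (G : loads n -> R).

(** The transition operator of the chain. All [n] choices are averaged over, including those that
    the round ignores, so that the sample space does not depend on [x]. *)
Definition avg G x : R :=
  (n%:R ^+ n)^-1 * \sum_(c : {ffun 'I_n -> 'I_n}) G (rbb_step x c).

Definition expsum (a : R) x : R := \sum_(i < n) a ^+ x i.

Definition drained x (i : 'I_n) : nat := (x i - (0 < x i)%N)%N.

Lemma natn_gt0 : 0 < n%:R :> R. Proof. by rewrite ltr0n. Qed.
Let nn0 : n%:R != 0 :> R. Proof. by rewrite gt_eqF ?natn_gt0. Qed.
Let nX0 : 0 < (n%:R ^+ n)^-1 :> R.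
Proof. by rewrite invr_gt0 exprn_gt0 ?natn_gt0. Qed.

Lemma nonempty_bins_le x : (nonempty_bins x <= n)%N.
Proof. by rewrite -[leqRHS](card_ord n) max_card. Qed.

Lemma card_ord_lt k : (k <= n)%N -> #|[pred j : 'I_n | (j < k)%N]| = k.
Proof.
move=> kn; rewrite -sum1_card.
by rewrite -(big_ord_widen n (fun=> 1%N) kn) sum1_card card_ord.
Qed.

Lemma sum_emptyE x :
  \sum_(i < n) (x i == 0%N)%:R = n%:R - (nonempty_bins x)%:R :> R.
Proof.
rewrite /nonempty_bins -sum1_card natr_sum [X in _ - X]big_mkcond /=.
apply/eqP; rewrite eq_sym subr_eq; apply/eqP.
rewrite -big_split /= (eq_bigr (fun=> 1)) => [|i _].
  by rewrite sumr_const card_ord.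
by rewrite inE; case: (x i) => [|k]; rewrite /= ?addr0 ?add0r.
Qed.

Lemma sum_rbb_step x c : (\sum_(i < n) rbb_step x c i = \sum_(i < n) x i)%N.
Proof.
under eq_bigr do rewrite ffunE.
rewrite big_split /= exchange_big /=.
rewrite [X in (_ + X)%N](eq_bigr (fun=> 1%N)); last first.
  by move=> j _; rewrite (bigD1 (c j)) //= eqxx big1 // => i /negbTE; rewrite eq_sym => ->.
rewrite sum1_card card_ord_lt ?nonempty_bins_le // /nonempty_bins.
rewrite -sum1_card [X in (_ + X)%N]big_mkcond -big_split /=.
by apply: eq_bigr => i _; rewrite inE; case: (x i) => // l; rewrite /= subn1 addn1.
Qed.

(** Independence of the choices: the sum over functions factorises, and each of the [n - k] ignored
    coordinates gives a factor [n] that the normalisation cancels. *)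
Lemma avg_prod (phi : 'I_n -> R) k : (k <= n)%N ->
  (n%:R ^+ n)^-1 *
  \sum_(c : {ffun 'I_n -> 'I_n}) \prod_(j < n | (j < k)%N) phi (c j) =
  ((\sum_b phi b) / n%:R) ^+ k.
Proof.
move=> kn; under eq_bigr do rewrite big_mkcond /=.
rewrite -(bigA_distr_bigA (fun (j : 'I_n) b => if (j < k)%N then phi b else 1)).
rewrite (bigID (fun j : 'I_n => (j < k)%N)) /=.
rewrite (eq_bigr (fun=> \sum_b phi b)); last by move=> j ->.
rewrite [X in _ * (_ * X)](eq_bigr (fun=> n%:R)); last first.
  by move=> j /negbTE ->; rewrite sumr_const card_ord.
rewrite !prodr_const card_ord_lt //.
have -> : #|[pred j : 'I_n | ~~ (j < k)%N]| = (n - k)%N.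
  rewrite -[X in (X - _)%N](card_ord n) -{2}(card_ord_lt kn).
  by rewrite -(cardC [pred j : 'I_n | (j < k)%N]) addKn; apply: eq_card.
rewrite expr_div_n mulrCA; congr (_ * _).
apply: (mulfI (expf_neq0 n nn0)); rewrite mulVKf ?expf_neq0 //.
have -> : n%:R ^+ n = n%:R ^+ (n - k) * n%:R ^+ k :> R by rewrite -exprD subnK.
by rewrite mulfK ?expf_neq0.
Qed.

Lemma avgD G1 G2 x : avg (fun y => G1 y + G2 y) x = avg G1 x + avg G2 x.
Proof. by rewrite /avg big_split mulrDr. Qed.

Lemma avgZ a G x : avg (fun y => a * G y) x = a * avg G x.
Proof. by rewrite /avg -mulr_sumr mulrCA. Qed.

Lemma avg_sum (I : finType) (G : I -> loads n -> R) x :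
  avg (fun y => \sum_i G i y) x = \sum_i avg (G i) x.
Proof. by rewrite /avg exchange_big mulr_sumr. Qed.

Lemma avg_cst a x : avg (fun=> a) x = a.
Proof.
rewrite /avg sumr_const card_ffun card_ord -[a *+ _]mulr_natr natrX mulrCA.
by rewrite mulVf ?mulr1 // expf_neq0.
Qed.

Lemma ler_avg G1 G2 x :
  (forall c, G1 (rbb_step x c) <= G2 (rbb_step x c)) -> avg G1 x <= avg G2 x.
Proof. by move=> H; rewrite /avg ler_pM2l //; apply: ler_sum. Qed.

Lemma rbb_stepE x c i : rbb_step x c i =
  (drained x i + \sum_(j < n | (j < nonempty_bins x)%N) (c j == i))%N.
Proof. by rewrite ffunE. Qed.

Lemma avg_monomial2 (a q : R) x i l :
  avg (fun y => a ^+ y i * q ^+ y l) x =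
  a ^+ drained x i * q ^+ drained x l *
  ((\sum_(b < n) a ^+ (b == i) * q ^+ (b == l)) / n%:R) ^+ nonempty_bins x.
Proof.
rewrite -avg_prod ?nonempty_bins_le // mulrCA; congr (_ * _).
rewrite mulr_sumr; apply: eq_bigr => c _.
by rewrite !rbb_stepE !exprD -!prodrXr big_split /= mulrACA.
Qed.

Lemma sum_expr_eq (a : R) i : \sum_(b < n) a ^+ (b == i) = n%:R + (a - 1).
Proof.
rewrite (bigD1 i) //= eqxx expr1 (eq_bigr (fun=> 1)) => [|b /negbTE ->] //.
rewrite sumr_const cardC1 card_ord.
have -> : n%:R = n.-1%:R + 1 :> R by rewrite natr1 prednK.
ring.
Qed.

Lemma sum_expr_eq2 (a q : R) i l : \sum_(b < n) a ^+ (b == i) * q ^+ (b == l) =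
  n%:R + (a - 1) + (q - 1) + (i == l)%:R * ((a - 1) * (q - 1)).
Proof.
have [<-|il] := eqVneq i l.
  under eq_bigr do rewrite -exprMn.
  by rewrite sum_expr_eq /=; ring.
(* For [i != l] at most one of the two exponents is non-zero, so the product of the powers is their
   sum minus 1. *)
rewrite /= (eq_bigr (fun b => a ^+ (b == i) + (q ^+ (b == l) - 1))) => [|b _].
  by rewrite big_split sumrB /= !sum_expr_eq sumr_const card_ord; ring.
have [->|bi] := eqVneq b i.
  by rewrite (negbTE il); ring.
by rewrite expr0; ring.
Qed.

Lemma avg_monomial (a : R) x i : avg (fun y => a ^+ y i) x =
  a ^+ drained x i * (1 + (a - 1) / n%:R) ^+ nonempty_bins x.
Proof.
have -> : avg (fun y => a ^+ y i) x = avg (fun y => a ^+ y i * 1 ^+ y i) x.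
  by congr avg; apply/funext => y; rewrite expr1n mulr1.
rewrite avg_monomial2 sum_expr_eq2 expr1n mulr1; congr (_ * _ ^+ _).
by field.
Qed.

(** Multiplying by [a] restores the removed ball in each non-empty bin; each empty bin then counts
    [a] instead of 1. *)
Lemma sum_drained (a : R) x : a * \sum_(i < n) a ^+ drained x i =
  expsum a x + (a - 1) * (n%:R - (nonempty_bins x)%:R).
Proof.
rewrite -sum_emptyE !mulr_sumr -big_split /=; apply: eq_bigr => i _.
rewrite /drained; case: (x i) => [|l] /=.
  by rewrite subn0 expr0; ring.
by rewrite subn1 /= exprS; ring.
Qed.

Lemma avg_expsum (a : R) x : avg (expsum a) x =
  (1 + (a - 1) / n%:R) ^+ nonempty_bins x * \sum_(i < n) a ^+ drained x i.
Proof.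
rewrite /expsum avg_sum mulr_sumr; apply: eq_bigr => i _.
by rewrite avg_monomial mulrC.
Qed.

(* The arrivals at two bins are almost uncorrelated: the generating function of
   each pair of loads is an explicit k-th power, k being the number of balls. *)
Lemma avg_expsum_mul_ge (eta p : R) x :
  0 <= p <= 1/2 -> 0 <= eta <= 1/2 ->
  (1 - 2 * (eta * p)) * (avg (expsum (1 + eta)) x * avg (expsum (1 - p)) x) <=
  avg (fun y => expsum (1 + eta) y * expsum (1 - p) y) x.
Proof.
move=> hp he; have B := decorrelation_base n_gt0 hp he.
have /andP[p0 p1] := hp; have /andP[e0 e1] := he.
set k := nonempty_bins x.
set Ma := (1 + eta / n%:R) ^+ k; set Mq := (1 - p / n%:R) ^+ k.
have v0 : 0 < n%:R^-1 :> R by rewrite invr_gt0 natn_gt0.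
have v1 : n%:R^-1 <= 1 :> R by rewrite invf_le1 ?natn_gt0 // ler1n.
have pn1 : p / n%:R <= 1 by nra.
have pn0 : 0 <= p / n%:R by rewrite mulr_ge0 // ltW.
have en0 : 0 <= eta / n%:R by rewrite mulr_ge0 // ltW.
have ep0 : 0 <= eta * p by rewrite mulr_ge0.
have ep1 : eta * p <= 1/2 by nra.
(* It suffices to compare one pair of bins at a time; the case [i = l] is the worst. *)
have K : forall i l, (1 - 2 * (eta * p)) * (Ma * Mq) <=
    ((\sum_(b < n) (1 + eta) ^+ (b == i) * (1 - p) ^+ (b == l)) / n%:R) ^+ k.
  move=> i l; rewrite sum_expr_eq2.
  have -> : (n%:R + (1 + eta - 1) + (1 - p - 1) +
    (i == l)%:R * ((1 + eta - 1) * (1 - p - 1))) / n%:R =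
    1 + (eta - p - (i == l)%:R * (eta * p)) / n%:R by field.
  have B2 : (1 + eta / n%:R) * (1 - p / n%:R) * (1 - 2 * (eta * p) / n%:R)
      <= 1 + (eta - p - (i == l)%:R * (eta * p)) / n%:R.
    have /andP[_ B1] := B; apply: le_trans B1 _.
    rewrite lerD2l ler_pM2r // lerD2l lerN2.
    by case: (i == l); rewrite ?mul1r ?mul0r.
  have /andP[B0 _] := B.
  apply: le_trans (lerXn2r k _ _ B2); rewrite ?nnegrE //; last exact: le_trans B2.
  rewrite !exprMn -/Ma -/Mq mulrC; apply: ler_wpM2l.
    by rewrite mulr_ge0 ?exprn_ge0 ?subr_ge0 ?addr_ge0.
  (* The per-ball losses add up to at most [2 eta p], since [k <= n]. *)
  have Bk : 1 - k%:R * (2 * (eta * p) / n%:R) <= (1 - 2 * (eta * p) / n%:R) ^+ k.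
    by apply: bernoulli_ge; apply/andP; split; nra.
  apply: le_trans Bk; rewrite lerD2l lerN2.
  have kn : k%:R / n%:R <= 1 :> R.
    by rewrite ler_pdivrMr ?natn_gt0 // mul1r ler_nat nonempty_bins_le.
  have -> : k%:R * (2 * (eta * p) / n%:R) = (k%:R / n%:R) * (2 * (eta * p)) by field.
  nra.
rewrite !avg_expsum.
have -> : 1 + (1 + eta - 1) / n%:R = 1 + eta / n%:R by field.
have -> : 1 + (1 - p - 1) / n%:R = 1 - p / n%:R by field.
rewrite -/k -/Ma -/Mq.
have -> : avg (fun y => expsum (1 + eta) y * expsum (1 - p) y) x =
  \sum_i \sum_l avg (fun y => (1 + eta) ^+ y i * (1 - p) ^+ y l) x.
  rewrite -(eq_bigr _ (fun i _ => avg_sum _ x)) -avg_sum; congr avg.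
  apply/funext => y; rewrite /expsum mulr_suml; apply: eq_bigr => i _.
  by rewrite mulr_sumr.
rewrite [Ma * _ * _]mulrACA [leLHS]mulrA mulr_suml mulr_sumr; apply: ler_sum => i _.
rewrite !mulr_sumr; apply: ler_sum => l _.
rewrite avg_monomial2 mulrC; apply: ler_wpM2l; last exact: K.
by rewrite mulr_ge0 // exprn_ge0; lra.
Qed.

End Step.

(** * Drift of the potential, in one round and in many *)

Section Drift.
Variables (R : realType) (n : nat).
Hypothesis n_gt0 : (0 < n)%N.
Implicit Types (x : loads n) (G : loads n -> R).

Definition frac_empty x : R := 1 - (nonempty_bins x)%:R / n%:R.

Lemma frac_empty_ge0 x : 0 <= frac_empty x.
Proof.
by rewrite subr_ge0 ler_pdivrMr ?ltr0n // mul1r ler_nat nonempty_bins_le.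
Qed.

Lemma frac_empty_le1 x : frac_empty x <= 1.
Proof. by rewrite lerBlDr lerDl divr_ge0. Qed.

Lemma sum_drained_frac (a : R) x : a * \sum_(i < n) a ^+ drained x i =
  expsum a x + (a - 1) * (n%:R * frac_empty x).
Proof.
rewrite sum_drained /frac_empty; congr (_ + _ * _).
by rewrite mulrBr mulr1 mulrCA divff ?mulr1 // gt_eqF ?ltr0n.
Qed.

Lemma expsum_ge0 (a : R) x : 0 <= a -> 0 <= expsum a x.
Proof. by move=> a0; rewrite sumr_ge0 // => i _; rewrite exprn_ge0. Qed.

Let natr_ordE : n%:R = \sum_(i < n) 1 :> R.
Proof. by rewrite sumr_const card_ord. Qed.

Lemma expsum_le (a : R) x : 0 <= a <= 1 -> expsum a x <= n%:R.
Proof.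
move=> /andP[a0 a1]; rewrite [leRHS]natr_ordE.
by apply: ler_sum => i _; rewrite exprn_ile1.
Qed.

(** Bernoulli's inequality in every bin. For [p m <= n / 2] it shows that psi is at least 1/2. *)
Lemma expsum_ge_tangent (p : R) x : 0 <= p <= 1 ->
  n%:R - p * (\sum_(i < n) x i)%:R <= expsum (1 - p) x.
Proof.
move=> p01; rewrite [X in X - _]natr_ordE natr_sum mulr_sumr -sumrB.
by apply: ler_sum => i _; rewrite mulrC bernoulli_ge.
Qed.

Lemma avg_expsum_growth (eta : R) x : 0 <= eta <= 1/2 ->
  avg (expsum (1 + eta)) x <=
  (1 - eta * frac_empty x + 3 * eta ^+ 2) *
  (expsum (1 + eta) x + eta * (n%:R * frac_empty x)).
Proof.
move=> he; have /andP[e0 e1] := he.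
have G := growth_factor_le (nonempty_bins_le x) n_gt0 he.
rewrite avg_expsum //.
have -> : 1 + eta - 1 = eta by ring.
have S0 : 0 <= \sum_(i < n) (1 + eta) ^+ drained x i.
  by rewrite sumr_ge0 // => i _; rewrite exprn_ge0 ?addr_ge0.
apply: le_trans (ler_wpM2r S0 G) _; rewrite -/(frac_empty x).
have := sum_drained_frac (1 + eta) x.
have -> : 1 + eta - 1 = eta by ring.
by move=> <-; rewrite [leRHS]mulrA [X in X * _ <= _]mulrC.
Qed.

(** The arrivals multiply by at least [(1 - p/n)^n >= (1 + p^2/8) (1 - p)], and [1 - p] cancels
    against the drain, leaving [(1 + p^2/8) (psi - p f)]. As psi is at least 1/2, the second-order
    gain is at least [p^2 / 16]; the remaining cross term fits into [2 p f]. *)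
Lemma avg_expsum_decay (p : R) x : (1 < n)%N -> 0 <= p <= 1/2 ->
  p * (\sum_(i < n) x i)%:R <= n%:R / 2 ->
  expsum (1 - p) x / n%:R + p ^+ 2 / 16 - 2 * p * frac_empty x <=
  avg (expsum (1 - p)) x / n%:R.
Proof.
move=> n1 hp pm; have /andP[p0 p1] := hp.
have nR0 : 0 < n%:R :> R by rewrite ltr0n.
have p01 : 0 <= p <= 1 by rewrite p0; lra.
have T := expsum_ge_tangent x p01.
have f0 := frac_empty_ge0 x; have f1 := frac_empty_le1 x.
have E := sum_drained_frac (1 - p) x.
rewrite avg_expsum //.
set S := \sum_(i < n) _ in E *; set f := frac_empty x in f0 f1 E *.
set Y := expsum (1 - p) x in T E *.
have S0 : 0 <= S by rewrite sumr_ge0 // => i _; rewrite exprn_ge0; lra.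
have -> : 1 + (1 - p - 1) / n%:R = 1 - p / n%:R :> R by field; rewrite gt_eqF.
have v0 : 0 <= p / n%:R by rewrite divr_ge0 // ltW.
have v1 : p / n%:R <= 1.
  by rewrite ler_pdivrMr // mul1r (le_trans p1) // (le_trans _ (_ : 1 <= _)) ?ler1n //; lra.
have M : (1 + p ^+ 2 / 8) * (1 - p) <= (1 - p / n%:R) ^+ nonempty_bins x.
  apply: le_trans (ler_wiXn2l _ _ (nonempty_bins_le x)); [|lra|lra].
  apply: le_trans (bernoulli2_ge n1 p01).
  have : 0 <= p * p ^+ 2 by rewrite mulr_ge0 ?sqr_ge0.
  lra.
have {}M := ler_wpM2r S0 M; rewrite -mulrA E in M.
rewrite ler_pdivlMr //; apply: le_trans M.
have -> : (Y / n%:R + p ^+ 2 / 16 - 2 * p * f) * n%:R =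
   Y + p ^+ 2 / 16 * n%:R - 2 * (p * f * n%:R) by field; rewrite gt_eqF.
have pfn : 0 <= p * f * n%:R by rewrite !mulr_ge0 // ltW.
have q0 : 0 <= p ^+ 2 by rewrite sqr_ge0.
have q1 : p ^+ 2 <= 1 by rewrite expr2; nra.
have H1 : p ^+ 2 * (n%:R / 2) <= p ^+ 2 * Y by rewrite ler_wpM2l //; lra.
have H2 : p ^+ 2 * (p * f * n%:R) <= p * f * n%:R by rewrite ler_piMl.
have -> : (1 + p ^+ 2 / 8) * (Y + (1 - p - 1) * (n%:R * f)) =
  Y - p * f * n%:R + (p ^+ 2 * Y - p ^+ 2 * (p * f * n%:R)) / 8 by field.
lra.
Qed.

(* Here eta = p/512.  The constant 1537 = 1 + 3 * 512 makes the second factor at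
   least 3 p/eta, so that the loss eta f in the first factor outweighs the term
   2 p f by which the mean of (1-p)^(x_i) may decrease. *)
Definition potential (p : R) x : R :=
  expsum (1 + p / 512) x * (1537 - expsum (1 - p) x / n%:R).

(** The loss [eta f D] is about [3 p f] and beats [2 p f]. The terms [3 eta^2 D] and [2 eta p] are
    small multiples of [p^2], absorbed by [p^2 / 16]. *)
Lemma drift_arith (p f D : R) : 0 <= p <= 1/2 -> 0 <= f <= 1 ->
  1536 <= D <= 1537 ->
  (1 - p / 512 * f + 3 * (p / 512) ^+ 2) *
    (D - p ^+ 2 / 16 + 2 * p * f + 2 * (p / 512 * p)) <= D - p ^+ 2 / 64.
Proof.
move=> /andP[p0 p1] /andP[f0 f1] /andP[D0 D1].
set D' := D - _ + _ + _.
have pf0 : 0 <= p * f by rewrite mulr_ge0.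
have pf1 : p * f <= 1 by nra.
have q0 : 0 <= p ^+ 2 by rewrite sqr_ge0.
have q1 : p ^+ 2 <= 1 by rewrite expr2; nra.
have DE : D' = D - p ^+ 2 / 16 + 2 * (p * f) + p ^+ 2 / 256.
  by rewrite /D'; field.
have H1 : (p * f) * 1535 <= (p * f) * D' by rewrite ler_wpM2l // DE; lra.
have H2 : p ^+ 2 * D' <= p ^+ 2 * 1540 by rewrite ler_wpM2l // DE; lra.
have -> : (1 - p / 512 * f + 3 * (p / 512) ^+ 2) * D' =
  D' - (p * f) * D' / 512 + 3 * (p ^+ 2 * D') / 512 / 512 by ring.
lra.
Qed.

(** Here [X] and [Y] stand for Phi and psi, [EX], [EY], [EXY] for the averages after one round, and
    [D'] bounds [A - EY] plus the correlation error. *)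
Lemma drift_combine (p e f A N D D' X Y EX EY EXY : R) :
  0 <= p <= 1/2 -> 2 <= A -> 0 <= e -> 0 <= f <= 1 -> 0 <= N -> 0 <= X -> 0 <= EX ->
  D = A - Y -> 0 <= Y <= 1 -> EY <= 1 ->
  (1 - 2 * (e * p)) * (EX * EY) <= EXY ->
  D - p ^+ 2 / 16 + 2 * p * f + 2 * (e * p) = D' ->
  Y + p ^+ 2 / 16 - 2 * p * f <= EY ->
  EX <= (1 - e * f + 3 * e ^+ 2) * (X + e * (N * f)) ->
  (1 - e * f + 3 * e ^+ 2) * D' <= D - p ^+ 2 / 64 ->
  A * EX - EXY <=
  (1 - p ^+ 2 / (64 * A)) * (X * D) + e * N * A.
Proof.
move=> /andP[p0 p1] A2 e0 /andP[f0 f1] N0 X0 EX0 DE /andP[Y0 Y1] EY1 Co D'E De Gr Ar.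
have q0 : 0 <= p ^+ 2 by rewrite sqr_ge0.
have q1 : p ^+ 2 <= 1 by rewrite exprn_ile1 //; clear -p1; lra.
have pf0 : 0 <= p * f by rewrite mulr_ge0.
have ep0 : 0 <= e * p by rewrite mulr_ge0.
have D0 : 1 <= D by clear -DE Y1 A2; lra.
have D1 : D <= A by clear -DE Y0; lra.
have D'0 : 0 <= D' by clear -D'E D0 q1 pf0 ep0; lra.
have nf : N * f <= N by rewrite ler_piMr.
have nf0 : 0 <= N * f by rewrite mulr_ge0.
have step1 : A * EX - EXY <= EX * D'.
  have H1 : EX * (A - EY + 2 * (e * p)) <= EX * D'.
    by rewrite ler_wpM2l //; clear -D'E DE De; lra.
  have H2 : EX * (e * p) * EY <= EX * (e * p).
    by rewrite ler_piMr // mulr_ge0.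
  by clear -H1 H2 Co; lra.
have step2 := ler_wpM2r D'0 Gr.
have XF0 : 0 <= X + e * (N * f) by rewrite addr_ge0 // mulr_ge0.
have step3 := ler_wpM2l XF0 Ar.
have H1 : e * (N * f) * (D - p ^+ 2 / 64) <= e * N * A.
  apply: ler_pM; [by rewrite mulr_ge0 | by clear -D0 q1; lra | | ].
    by rewrite ler_wpM2l.
  by clear -D1 q0; lra.
(* Since [D <= A], the loss [X p^2 / 64] is at least the fraction [p^2 / (64 A)] of the potential
   [X D]. *)
have H2 : X * p ^+ 2 * D <= X * p ^+ 2 * A by rewrite ler_wpM2l // mulr_ge0.
have A0 : 0 < A by clear -A2; lra.
have H3 : X * p ^+ 2 * D / (64 * A) <= X * p ^+ 2 / 64.
  by rewrite invfM mulrA [leLHS]mulrAC ler_pM2r ?invr_gt0 // ler_pdivrMr.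
have -> : (1 - p ^+ 2 / (64 * A)) * (X * D) = X * D - X * p ^+ 2 * D / (64 * A).
  by set l := (64 * A)^-1; ring.
apply: le_trans step1 _; apply: le_trans step2 _.
rewrite [_ * D']mulrAC [_ * D' * _]mulrC; apply: le_trans step3 _.
move: H1 H3; set l := _ / (64 * A); set v := e * N * A; set u := p ^+ 2.
clear; lra.
Qed.

Lemma avg_potential_le (p : R) x : (1 < n)%N -> 0 < p <= 1/2 ->
  p * (\sum_(i < n) x i)%:R <= n%:R / 2 ->
  avg (potential p) x <=
  (1 - p ^+ 2 / (64 * 1537)) * potential p x + p / 512 * n%:R * 1537.
Proof.
move=> n1 /andP[p0 p1] pm.
have hp : 0 <= p <= 1/2 by rewrite ltW.
have he : 0 <= p / 512 <= 1/2 by lra.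
have hq : 0 <= 1 - p <= 1 by lra.
have a0 : 0 <= 1 + p / 512 by lra.
have nR0 : 0 < n%:R :> R by rewrite ltr0n.
have f0 := frac_empty_ge0 x; have f1 := frac_empty_le1 x.
have Gr := avg_expsum_growth x he.
have De := avg_expsum_decay n1 hp pm.
have Co := avg_expsum_mul_ge n_gt0 x hp he.
have Y1 : expsum (1 - p) x / n%:R <= 1 by rewrite ler_pdivrMr // mul1r expsum_le.
have Y0 : 0 <= expsum (1 - p) x / n%:R by rewrite divr_ge0 ?expsum_ge0 ?ltW //; lra.
have EY1 : avg (expsum (1 - p)) x / n%:R <= 1.
  rewrite ler_pdivrMr // mul1r -(avg_cst n_gt0 n%:R x).
  by apply: ler_avg => // c; apply: expsum_le.
have X0 : 0 <= expsum (1 + p / 512) x by rewrite expsum_ge0.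
have EX0 : 0 <= avg (expsum (1 + p / 512)) x.
  by rewrite -(avg_cst n_gt0 0 x); apply: ler_avg => // c; rewrite expsum_ge0.
have -> : avg (potential p) x = 1537 * avg (expsum (1 + p / 512)) x +
   - n%:R^-1 * avg (fun y => expsum (1 + p / 512) y * expsum (1 - p) y) x.
  rewrite -!avgZ -avgD; congr avg; apply/funext => y.
  by rewrite /potential; ring.
rewrite /potential.
set X := expsum (1 + p / 512) x in X0 Gr *.
set EX := avg (expsum (1 + p / 512)) x in EX0 Gr Co *.
set Y := expsum (1 - p) x / n%:R in Y0 Y1 De *.
set EXY := avg (fun y => _ * _) x in Co *.
set f := frac_empty x in f0 f1 Gr De *.
have Co' : (1 - 2 * (p / 512 * p)) * (EX * (avg (expsum (1 - p)) x / n%:R))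
    <= n%:R^-1 * EXY.
  rewrite ler_pdivlMl //; apply: le_trans Co.
  by rewrite mulrC -!mulrA mulVf ?mulr1 // gt_eqF.
set EY := avg (expsum (1 - p)) x / n%:R in De EY1 Co' *.
clearbody X EX Y EXY f EY; clear Co.
have hD : 1536 <= 1537 - Y <= 1537 by clear -Y0 Y1; apply/andP; split; lra.
have hf : 0 <= f <= 1 by rewrite f0.
have Ar := drift_arith hp hf hD.
rewrite mulNr; apply: (drift_combine hp _ _ hf (ltW nR0) X0 EX0 erefl _ EY1 Co' erefl De Gr Ar).
- by rewrite ler_nat.
- by have /andP[] := he.
by rewrite Y0.
Qed.

(** The one-round bound is an affine contraction with fixed point [1537^2 n / (8 p)]; its iterates
    are convex combinations of the initial potential and this fixed point. *)
Lemma iter_avg_potential_le (p : R) m t x : (1 < n)%N -> 0 < p <= 1/2 ->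
  p * m%:R <= n%:R / 2 -> (\sum_(i < n) x i)%N = m ->
  iter t (@avg R n) (potential p) x <=
  (1 - p ^+ 2 / (64 * 1537)) ^+ t * potential p x
  + (1 - (1 - p ^+ 2 / (64 * 1537)) ^+ t) * (1537 ^+ 2 * n%:R / (8 * p)).
Proof.
move=> n1 hp pm; have /andP[p0 p1] := hp.
have q0 : 0 <= p ^+ 2 by rewrite sqr_ge0.
have q1 : p ^+ 2 <= 1 by rewrite expr2; nra.
set r := 1 - p ^+ 2 / _; set B := _ / (8 * p).
have r0 : 0 <= r by rewrite /r; lra.
elim: t x => [|t IH] x xm; first by rewrite expr0 /= mul1r subrr mul0r addr0.
rewrite iterS.
apply: (@le_trans _ _
  (avg (fun y => r ^+ t * potential p y + (1 - r ^+ t) * B) x)).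
  by apply: ler_avg => // c; apply: IH; rewrite sum_rbb_step.
rewrite avgD avgZ avg_cst //.
have := avg_potential_le (x := x) n1 hp; rewrite xm => /(_ pm).
rewrite -/r; have -> : p / 512 * n%:R * 1537 = (1 - r) * B.
  have E (A : R) : A != 0 -> p / 512 * n%:R * A =
      (1 - (1 - p ^+ 2 / (64 * A))) * (A ^+ 2 * n%:R / (8 * p)).
    by move=> A0; field; rewrite A0 gt_eqF.
  by apply: E; rewrite pnatr_eq0.
move=> H; have := ler_wpM2l (exprn_ge0 t r0) H.
by rewrite exprSr; lra.
Qed.

Lemma ler_iter_avg t G1 G2 x : (forall y, G1 y <= G2 y) ->
  iter t (@avg R n) G1 x <= iter t (@avg R n) G2 x.
Proof.
move=> H; elim: t x => [|t IH] x; first exact: H.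
by rewrite !iterS; apply: ler_avg.
Qed.

Lemma iter_avgZ t a G x :
  iter t (@avg R n) (fun y => a * G y) x = a * iter t (@avg R n) G x.
Proof.
elim: t x => [//|t IH] x; rewrite !iterS -avgZ; congr avg; exact/funext.
Qed.

Lemma iter_avg_sum t (I : finType) (G : I -> loads n -> R) x :
  iter t (@avg R n) (fun y => \sum_i G i y) x = \sum_i iter t (@avg R n) (G i) x.
Proof.
elim: t x => [//|t IH] x; rewrite !iterS -avg_sum; congr avg; exact/funext.
Qed.

End Drift.

(** * Potential after mixing, and the tail of the maximum load *)

Section Tail.
Variables (R : realType) (n m : nat).
Hypotheses (n_gt1 : (1 < n)%N) (le_nm : (n <= m)%N).
Implicit Types (x : loads n).

Let n_gt0 : (0 < n)%N. Proof. exact: ltnW. Qed.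
(** The largest [p] for which the tangent bound still gives psi at least 1/2. *)
Let p : R := n%:R / (2 * m%:R).
Let nR0 : 0 < n%:R :> R. Proof. by rewrite ltr0n. Qed.
Let mR0 : 0 < m%:R :> R. Proof. by rewrite ltr0n (leq_trans n_gt0). Qed.
Let p_gt0 : 0 < p. Proof. by rewrite divr_gt0 // mulr_gt0. Qed.
Let p_le : p <= 1/2.
Proof.
rewrite /p invfM mulrCA mulrC div1r ler_piMl ?invr_ge0 //.
by rewrite ler_pdivrMr // mul1r ler_nat.
Qed.
Let pm : p * m%:R = n%:R / 2.
Proof. by rewrite /p; field; rewrite gt_eqF. Qed.

(** [exp(-h/2) >= 1 - h/2], and [(1 + h) (1 - h/2) >= 1] for [h] in the unit interval. *)
Lemma expR_half_le (h : R) : 0 <= h <= 1 -> expR (h / 2) <= 1 + h.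
Proof.
move=> /andP[h0 h1]; have := expR_ge1Dx (- (h / 2)); rewrite expRN => H.
have E0 := expR_gt0 (h / 2).
have : (1 - h / 2) * expR (h / 2) <= 1.
  by rewrite -ler_pdivlMr ?div1r.
have := ler_wpM2r (ltW E0) (_ : 1 <= (1 + h) * (1 - h / 2)).
rewrite mul1r => H2 H1; apply: le_trans (H2 _) _; first by nra.
rewrite -mulrA ler_piMr //; lra.
Qed.

Lemma potential_ge_max_load x : (1 + p / 512) ^+ max_load x <= potential p x.
Proof.
have [i xi] : exists i, max_load x = x i.
  have [|i xi] := @bigop.eq_bigmax 'I_n (fun i => x i); first by rewrite card_ord.
  by exists i.
have p0 := p_gt0; have p1 := p_le.
have X1 : (1 + p / 512) ^+ max_load x <= expsum (1 + p / 512) x.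
  have : 0 <= 1 + p / 512 by lra.
  move: (1 + p / 512) => a a0; rewrite xi /expsum (bigD1 i) // lerDl.
  by apply: sumr_ge0 => j _; rewrite exprn_ge0.
apply: le_trans X1 _; apply: ler_peMr; first by apply: expsum_ge0; lra.
have : expsum (1 - p) x / n%:R <= 1.
  by rewrite ler_pdivrMr // mul1r expsum_le //; lra.
lra.
Qed.

Lemma potential_ge_of_max_load (M : R) x : 0 <= M ->
  2048 * M * (m%:R / n%:R) * ln n%:R < (max_load x)%:R ->
  n%:R `^ M <= potential p x.
Proof.
move=> M0 H; apply: le_trans (potential_ge_max_load x).
have p0 := p_gt0; have p1 := p_le.
have h : 0 <= p / 512 <= 1 by lra.
apply: (@le_trans _ _ (expR (p / 512 / 2) ^+ max_load x)); last first.
  move: (p / 512) h => e e01; have /andP[e0 _] := e01.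
  by apply: lerXn2r; rewrite ?nnegrE ?expR_ge0 ?expR_half_le ?addr_ge0.
have -> : n%:R `^ M = expR (M * ln n%:R) by rewrite /powR gt_eqF.
rewrite -expRM_natl ler_expR.
(* The constant 2048 is [2 * 512 * 2]: from [p = n / (2 m)], from [eta = p / 512] and from the
   halved exponent. *)
have -> : M * ln n%:R = 2048 * M * (m%:R / n%:R) * ln n%:R * (p / 512 / 2).
  by move: (ln _) => u; rewrite /p; field; rewrite !gt_eqF.
apply: ler_wpM2r; last exact: ltW.
by rewrite !divr_ge0 ?ler0n // ltW.
Qed.

Lemma potential_le_init x : (\sum_(i < n) x i)%N = m ->
  potential p x <= 1537 * n%:R * expR (p / 512 * m%:R).
Proof.
move=> xm; have p0 := p_gt0; have p1 := p_le.
have X : expsum (1 + p / 512) x <= n%:R * expR (p / 512 * m%:R).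
  have -> : n%:R * expR (p / 512 * m%:R) = \sum_(i < n) expR (p / 512 * m%:R).
    by rewrite sumr_const card_ord mulr_natl.
  apply: ler_sum => i _; rewrite [_ * m%:R]mulrC expRM_natl.
  have xi : (x i <= m)%N by rewrite -xm (bigD1 i) //= leq_addr.
  have e0 : 0 <= p / 512 by lra.
  move: (p / 512) e0 => e e0; have a1 : 1 <= 1 + e by rewrite lerDl.
  apply: le_trans (ler_weXn2l a1 xi) _.
  by apply: lerXn2r; rewrite ?nnegrE ?expR_ge0 ?expR_ge1Dx ?addr_ge0.
have Y0 : 0 <= expsum (1 - p) x / n%:R.
  by apply: divr_ge0; [apply: expsum_ge0; lra | exact: ltW].
have Y1 : expsum (1 - p) x / n%:R <= 1.
  by rewrite ler_pdivrMr // mul1r; apply: expsum_le; lra.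
rewrite /potential mulrC -mulrA; apply: ler_pM; last exact: X.
- by lra.
- by apply: expsum_ge0; lra.
- by lra.
Qed.

Lemma iter_avg_potential_mixed t x : (\sum_(i < n) x i)%N = m ->
  512 * (m%:R ^+ 2 / n%:R) <= t%:R :> R ->
  iter t (@avg R n) (potential p) x <= 2 ^+ 21 * m%:R.
Proof.
move=> xm tm; have p0 := p_gt0; have p1 := p_le.
have hp : 0 < p <= 1/2 by rewrite p0.
have pm' : p * m%:R <= n%:R / 2 by rewrite pm.
have I := iter_avg_potential_le n_gt0 t n_gt1 hp pm' xm.
have V0 := potential_le_init xm.
have [A AE] : exists A : R, A = 1537 by exists 1537.
have A1 : 1 <= A by rewrite AE ler1n.
have [u uE] : exists u : R, u = 2 ^+ 10 by exists (2 ^+ 10).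
have Au : A <= 2 * u by rewrite AE uE -exprS -natrX ler_nat.
have u2 : 2 <= u by rewrite uE -natrX ler_nat.
rewrite -AE in I V0; apply: le_trans I _; clear AE.
have A0 : 0 < A by rewrite (lt_le_trans _ A1).
set l := p ^+ 2 / _.
have l0 : 0 <= l by rewrite /l divr_ge0 ?sqr_ge0 // mulr_ge0 ?ler0n // ltW.
have l1 : l <= 1.
  rewrite /l ler_pdivrMr ?mul1r; last by rewrite mulr_gt0 // ltr0n.
  apply: (@le_trans _ _ 1); last by lra.
  by apply: exprn_ile1; [exact: ltW | lra].
(* The contraction cancels the worst initial potential: [512 (m^2 / n) l = 4 p m / A], which is at
   least [p m / 512] because [A <= 2048]. *)
have r1 : (1 - l) ^+ t <= expR (- (p / 512 * m%:R)).
  apply: (@le_trans _ _ (expR (- l) ^+ t)).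
    apply: lerXn2r; rewrite ?nnegrE ?expR_ge0 ?expR_ge1Dx //.
    by rewrite subr_ge0.
  rewrite -expRM_natl ler_expR mulrN lerN2.
  apply: le_trans (ler_wpM2r l0 tm).
  have -> : 512 * (m%:R ^+ 2 / n%:R) * l = 4 * p * m%:R / A.
    have -> : n%:R = 2 * (p * m%:R) :> R by rewrite pm; field.
    by rewrite /l; field; rewrite !gt_eqF.
  rewrite ler_pdivlMr //.
  have pm0 : 0 <= p * m%:R by rewrite mulr_ge0 // ltW.
  have := ler_wpM2l pm0 Au; rewrite uE => H.
  have : p * m%:R * (2 * 2 ^+ 10) = 512 * (4 * p * m%:R) by ring.
  lra.
have r0 : 0 <= (1 - l) ^+ t by rewrite exprn_ge0 // subr_ge0.
have P1 : (1 - l) ^+ t * potential p x <= A * n%:R.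
  apply: le_trans (ler_wpM2l r0 V0) _.
  rewrite mulrCA; apply: ler_piMr; first by apply: mulr_ge0; exact: ltW.
  apply: le_trans (ler_wpM2r (expR_ge0 _) r1) _.
  by rewrite -expRD addNr expR0.
set B := A ^+ 2 * n%:R / (8 * p).
have BE : B = A ^+ 2 / 4 * m%:R.
  rewrite /B; have -> : n%:R = 2 * (p * m%:R) :> R by rewrite pm; field.
  by field; rewrite !gt_eqF.
have B0 : 0 <= B by rewrite BE mulr_ge0 ?divr_ge0 ?sqr_ge0 ?ler0n.
(* The first summand is what is left of the initial potential, the second the fixed point, equal to
   [A^2 m / 4]. *)
apply: (@le_trans _ _ (A * n%:R + B)).
  by rewrite lerD // ler_piMl // lerBlDr lerDl.
have nm : n%:R <= m%:R :> R by rewrite ler_nat.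
rewrite BE; apply: (@le_trans _ _ ((A + A ^+ 2 / 4) * m%:R)).
  by rewrite mulrDl lerD2r ler_wpM2l // ltW.
rewrite ler_pM2r // (_ : 2 ^+ 21 = 2 * (u * u)); last first.
  by rewrite uE -exprD -exprS.
have uu : 2 * u <= u * u by rewrite ler_wpM2r //; lra.
have AA : A * A <= (2 * u) * (2 * u) by apply: ler_pM => //; exact: ltW.
rewrite expr2; lra.
Qed.

(** Markov's inequality: the indicator of a large load is at most [n^(-M)] times the potential. *)
Lemma iter_avg_max_load_tail (M : R) t x : 0 <= M ->
  (\sum_(i < n) x i)%N = m ->
  512 * (m%:R ^+ 2 / n%:R) <= t%:R :> R ->
  iter t (@avg R n) (fun y =>
    (2048 * M * (m%:R / n%:R) * ln n%:R < (max_load y)%:R)%R%:R) x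
  <= 2 ^+ 21 * m%:R * n%:R `^ (- M).
Proof.
move=> M0 xm tm.
have nM0 : 0 < n%:R `^ M :> R by rewrite powR_gt0.
apply: (@le_trans _ _
  (iter t (@avg R n) (fun y => n%:R `^ (- M) * potential p y) x)).
  apply: ler_iter_avg => // y; rewrite powRN; have H := @potential_ge_of_max_load M y M0.
  move: H; case: (2048 * _ * _ * _ < _) => [/(_ isT) H|_].
    by rewrite mulrC ler_pdivlMr // mul1r.
  apply: mulr_ge0; first by rewrite invr_ge0 powR_ge0.
  apply: le_trans (potential_ge_max_load y).
  apply: exprn_ge0; apply: addr_ge0; first exact: ler01.
  by apply: divr_ge0; [exact: ltW | exact: ler0n].
rewrite iter_avgZ mulrC; apply: ler_wpM2r; first exact: powR_ge0.
exact: iter_avg_potential_mixed.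
Qed.

End Tail.

(** * The law of the process as an iterated average *)

Section Law.
Variables (R : realType) (n : nat) (d : measure_display).
Variables (T : measurableType d) (P : probability T R).
Variable z : nat -> 'I_n -> T -> 'I_n.
Hypotheses (n_gt0 : (0 < n)%N) (z_iid : iid_uniform_choices P z).
Implicit Types (c : {ffun 'I_n -> 'I_n}) (cs : seq {ffun 'I_n -> 'I_n}).
Implicit Types (x : loads n) (S : pred (loads n)).

(** A cylinder event fixing all [n] choices in each of the rounds from [t] on that [cs] lists. The
    default [[ffun l => l]] is never read, as [i < size cs]. *)
Definition rounds_eq t cs : set T :=
  [set w | forall i j, (i < size cs)%N ->
     z (t + i)%N j w = nth [ffun l => l] cs i j].

Let choices t cs : seq (nat * 'I_n) :=
  [seq (t + i, j)%N | i <- iota 0 (size cs), j <- enum 'I_n].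

Let value t cs (tj : nat * 'I_n) : set 'I_n :=
  [set nth [ffun l => l] cs (tj.1 - t) tj.2].

(** Written as a finite intersection over distinct pairs of round and ball, the event has the form
    to which mutual independence applies. *)
Let rounds_eqE t cs :
  rounds_eq t cs = \bigcap_(tj in [set` choices t cs])
    ((fun tj : nat * 'I_n => z tj.1 tj.2) tj @^-1` value t cs tj).
Proof.
apply/seteqP; split=> w /= H.
  move=> _ /= /allpairsP[[i j] /= [+ _ ->]]; rewrite mem_iota /= => ilt.
  by rewrite /value /= addKn; apply: H.
move=> i j ilt; have := H (t + i, j)%N; rewrite /value /= addKn; apply.
by apply: allpairs_f; rewrite ?mem_enum // mem_iota.
Qed.

Lemma measurable_rounds_eq t cs : measurable (rounds_eq t cs).
Proof.
rewrite rounds_eqE; apply: fin_bigcap_measurable => [|[s j] _].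
  exact: finite_seq.
by case: z_iid => mz _ _; apply: mz.
Qed.

Lemma prob_rounds_eq t cs :
  P (rounds_eq t cs) = ((n%:R ^+ n)^-1 ^+ size cs)%:E.
Proof.
case: z_iid => _ uz iz; rewrite rounds_eqE iz.
  rewrite (eq_bigr (fun=> (n%:R^-1)%:E)) => [|tj _]; last exact: uz.
  rewrite prodEFin big_const_seq count_predT iter_mulr mulr1; congr EFin.
  rewrite size_allpairs size_iota size_enum_ord mulnC exprM.
  by rewrite !exprVn.
apply: allpairs_uniq; rewrite ?iota_uniq ?enum_uniq //.
by move=> [i j] [i' j'] _ _ /= [/addnI -> ->].
Qed.

Lemma rounds_eq_cons t c cs w : rounds_eq t (c :: cs) w <->
  (forall j, z t j w = c j) /\ rounds_eq t.+1 cs w.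
Proof.
split=> [H|[H0 H] [|i] j ilt].
- split=> [j|i j ilt]; first by have := H 0%N j isT; rewrite addn0.
  by have := H i.+1 j ilt; rewrite addnS -addSn.
- by rewrite addn0; apply: H0.
- by rewrite addnS -addSn; apply: H.
Qed.

(** Partition according to the choices [c] made in round [t]; on each piece the event concerns only
    the state at time [t] and fixed choices from then on. *)
Lemma rbb_event_split t S cs x :
  [set w | S (rbb z x t.+1 w)] `&` rounds_eq t.+1 cs =
  \bigcup_(c in [set` index_enum {ffun 'I_n -> 'I_n}])
    ([set w | S (rbb_step (rbb z x t w) c)] `&` rounds_eq t (c :: cs)).
Proof.
apply/seteqP; split=> w /=.
  move=> [Sw Hw]; exists [ffun j => z t j w]; first by rewrite /= mem_index_enum.
  split; last by apply/rounds_eq_cons; split=> // j; rewrite ffunE.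
  by move: Sw => /=; congr (is_true (S (rbb_step _ _))); apply/funext => j; rewrite ffunE.
move=> [c _ [/= Sw /rounds_eq_cons[Hc Hw]]]; split=> //.
by move: Sw; congr (is_true (S (rbb_step _ _))); apply/funext => j; rewrite Hc.
Qed.

(* Keeping track of arbitrary later choices cs is what makes the induction on t
   go through: round t+1 is resolved by moving one round into cs. *)
Lemma rbb_event_law t S cs x :
  let E := [set w | S (rbb z x t w)] `&` rounds_eq t cs in
  measurable E /\
  P E = (iter t (@avg R n) (fun y => (S y)%:R) x
         * (n%:R ^+ n)^-1 ^+ size cs)%:E.
Proof.
elim: t S cs => [|t IH] S cs E.
  rewrite {}/E /=; case: (S x).
    have -> : [set _ : T | true] = setT by apply/seteqP.
    rewrite setTI mul1r; split; [exact: measurable_rounds_eq|].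
    exact: prob_rounds_eq.
  have -> : [set _ : T | false] = set0 by apply/seteqP; split=> w.
  by rewrite set0I measure0 mul0r; split; first exact: measurable0.
rewrite /E rbb_event_split.
have mF c : measurable ([set w | S (rbb_step (rbb z x t w) c)]
    `&` rounds_eq t (c :: cs)).
  by have [] := IH (fun y => S (rbb_step y c)) (c :: cs).
split; first by apply: fin_bigcup_measurable => //; exact: finite_seq.
rewrite measure_fin_bigcup //; first last.
  move=> c c' _ _ [w [[_ /rounds_eq_cons[Hc _]] [_ /rounds_eq_cons[Hc' _]]]].
  by apply/ffunP => j; rewrite -Hc -Hc'.
rewrite -fsbig_seq ?index_enum_uniq //=.
under eq_bigr => c _.
  have [_ ->] := IH (fun y => S (rbb_step y c)) (c :: cs).
  rewrite [size _]/= exprS mulrA; over.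
rewrite sumEFin; congr EFin.
(* The resolved round acts directly on the indicator of [S], so it is the innermost application of
   [avg]. *)
rewrite -mulr_suml -mulr_suml -iterS iterSr; congr (_ * _).
by rewrite -iter_avg_sum mulrC -iter_avgZ.
Qed.

Lemma measurable_rbb_event t S x : measurable [set w | S (rbb z x t w)].
Proof.
have [] := rbb_event_law t S [::] x.
by rewrite (_ : rounds_eq t [::] = setT) ?setIT //; apply/seteqP.
Qed.

Lemma prob_rbb_event t S x : P [set w | S (rbb z x t w)] =
  (iter t (@avg R n) (fun y => (S y)%:R) x)%:E.
Proof.
have [_] := rbb_event_law t S [::] x.
rewrite (_ : rounds_eq t [::] = setT) ?setIT ?expr0 ?mulr1 //.
exact/seteqP.
Qed.

(** Union bound on the complement; the window has [r + 1] rounds, both ends included. *)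
Lemma prob_rbb_bigcap_ge t0 r S x (e : R) :
  (forall s, (t0 <= s <= t0 + r)%N ->
     iter s (@avg R n) (fun y => (~~ S y)%:R) x <= e) ->
  ((1 - r.+1%:R * e)%:E <=
    P (\bigcap_(s in [set s | (t0 <= s <= t0 + r)%N])
         [set w | S (rbb z x s w)]))%E.
Proof.
move=> He; set A := \bigcap_(s in _) _.
have AE : ~` A = \big[setU/set0]_(i < r.+1) [set w | ~~ S (rbb z x (t0 + i) w)].
  rewrite -(bigcup_mkord _ (fun i => [set w | ~~ S (rbb z x (t0 + i) w)])).
  rewrite /A setC_bigcap; apply/seteqP; split=> w /=.
    move=> [s /= /andP[ts sr] /negP Sw]; exists (s - t0)%N => /=; first by lia.
    by rewrite subnKC.
  move=> [i /= ir Sw]; exists (t0 + i)%N; first by rewrite /=; lia.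
  exact/negP.
have mN i : measurable [set w | ~~ S (rbb z x i w)].
  exact: (measurable_rbb_event i (fun y => ~~ S y)).
have mA : measurable (~` A) by rewrite AE; apply: bigsetU_measurable.
have -> : P A = (1 - P (~` A))%E.
  by rewrite -probability_setC // setCK.
have : (P (~` A) <= (r.+1%:R * e)%:E)%E.
  apply: (@le_trans _ _ (\sum_(i < r.+1) e%:E)%E); last first.
    by rewrite sumEFin sumr_const card_ord mulr_natl.
  apply: le_trans.
    apply: (@content_subadditive _ _ _ P (~` A)
      (fun i => [set w | ~~ S (rbb z x (t0 + i) w)]) r.+1) => //.
    by rewrite AE.
  apply: lee_sum => i _.
  have /= -> := prob_rbb_event (t0 + i) (fun y => ~~ S y) x.
  rewrite lee_fin; apply: He.
  by have := ltn_ord i; lia.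
by move=> H; rewrite EFinB leeB.
Qed.

End Law.

(** * Choice of the constant and union bound over the window *)

Theorem theorem4p1 (R : realType) (k : R) (hk : 1 <= k) :
  let c_r : R := 16 * 384 ^+ 2 * 744 ^+ 2 in
  exists2 C : R, 0 < C &
    forall (n m : nat), (0 < n)%N -> (n <= m)%N -> m%:R <= n%:R `^ k ->
    forall (d : measure_display) (T : measurableType d) (P : probability T R)
      (z : nat -> 'I_n -> T -> 'I_n), iid_uniform_choices P z ->
    forall x0 : loads n, (\sum_(i < n) x0 i)%N = m ->
    forall t : nat, c_r * (m%:R ^+ 2 / n%:R) <= t%:R ->
    (P (\bigcap_(s in [set s : nat | (t <= s <= t + m ^ 2)%N])
          [set w | ((max_load (rbb z x0 s w))%:R
                     <= C * (m%:R / n%:R) * ln (n%:R : R))%R])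
       >= (1 - n%:R `^ (- (2 * k)))%:E)%E.
Proof.
move=> c_r; have k0 : 0 <= k by rewrite (le_trans _ hk).
(* The exponent pays [2 k] for the target, [3 k] for [m^3] (the number of rounds times the factor
   [m] of the tail bound) and 22 for the constant [2^22 <= n^22]. *)
have [M ME] : exists M : R, M = 5 * k + 22 by exists (5 * k + 22).
have M0 : 0 < M by rewrite ME; lra.
exists (2048 * M) => [|n m n0 nm mk d T P z iid x0 xm t tc].
  by apply: mulr_gt0 M0; rewrite ltr0n.
(* For [n = 1] the claimed lower bound is 0. *)
have [n1|n1] := leqP n 1.
  have nE : n = 1%N by apply/eqP; rewrite eqn_leq n1.
  have -> : n%:R = 1 :> R by rewrite nE.
  by rewrite powR1 subrr measure_ge0.
have nR0 : 0 < n%:R :> R by rewrite ltr0n.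
have mR0 : 0 < m%:R :> R by rewrite ltr0n (leq_trans n0).
(* The waiting time [c_r m^2 / n] exceeds the [512 m^2 / n] rounds that mixing requires. *)
have t512 s : (t <= s)%N -> 512 * (m%:R ^+ 2 / n%:R) <= s%:R :> R.
  move=> ts; apply: (@le_trans _ _ t%:R); last by rewrite ler_nat.
  apply: le_trans tc; apply: ler_wpM2r; first by rewrite divr_ge0 ?sqr_ge0 // ltW.
  have h1 : 512 <= 16 * 384 :> R by rewrite -natrM ler_nat.
  have h2 : 1 <= 384 :> R by rewrite ler1n.
  have h3 : 1 <= 744 ^+ 2 :> R by apply: exprn_ege1; rewrite ler1n.
  apply: le_trans h1 _; rewrite /c_r -[leLHS]mulr1.
  apply: ler_pM h3; [by rewrite -natrM ler0n | exact: ler01 |].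
  apply: ler_wpM2l; [exact: ler0n | rewrite expr2; apply: ler_peMr h2; exact: ler0n].
have := @prob_rbb_bigcap_ge R n d T P z n0 iid t (m ^ 2)
  (fun y => (max_load y)%:R <= 2048 * M * (m%:R / n%:R) * ln n%:R) x0
  (2 ^+ 21 * m%:R * n%:R `^ (- M)) _.
have tail s : (t <= s <= t + m ^ 2)%N ->
  iter s (@avg R n) (fun y =>
   (~~ ((max_load y)%:R <= 2048 * M * (m%:R / n%:R) * ln n%:R))%R%:R) x0
   <= 2 ^+ 21 * m%:R * n%:R `^ (- M).
  move=> /andP[ts _]; have H := iter_avg_max_load_tail n1 nm (ltW M0) xm (t512 s ts).
  apply: le_trans H; apply: ler_iter_avg => // y; by rewrite -ltNge.
move=> /(_ tail); apply: le_trans; rewrite lee_fin lerD2l lerN2.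
have m1 : 1 <= m%:R :> R by rewrite ler1n (leq_trans n0).
have two : (m ^ 2).+1%:R <= 2 * (m%:R ^+ 2) :> R.
  by rewrite -natr1 natrX expr2; nra.
have m3 : m%:R ^+ 3 <= n%:R `^ (3 * k).
  have -> : n%:R `^ (3 * k) = (n%:R `^ k) ^+ 3.
    by rewrite (mulrC 3 k) powRrM powR_mulrn ?powR_ge0.
  by rewrite lerXn2r ?nnegrE ?powR_ge0 ?ler0n.
have n22 : 2 ^+ 22 <= n%:R `^ 22 :> R.
  have -> : n%:R `^ 22 = n%:R ^+ 22 :> R by rewrite -powR_mulrn ?ler0n.
  by rewrite lerXn2r ?nnegrE ?ler0n // ler_nat.
have nM0 : 0 <= n%:R `^ (- M) by rewrite powR_ge0.
apply: (@le_trans _ _ (2 * m%:R ^+ 2 * (2 ^+ 21 * m%:R * n%:R `^ (- M)))).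
  apply: ler_wpM2r two; apply: mulr_ge0 nM0.
  by apply: mulr_ge0; [rewrite exprn_ge0 ?ler0n | exact: ltW].
have -> : 2 * m%:R ^+ 2 * (2 ^+ 21 * m%:R * n%:R `^ (- M)) =
  (2 ^+ 22 * m%:R ^+ 3) * n%:R `^ (- M) by rewrite (exprS 2 21); move: (2 ^+ 21) => u; ring.
apply: (@le_trans _ _ (n%:R `^ 22 * n%:R `^ (3 * k) * n%:R `^ (- M))).
  apply: ler_wpM2r => //; apply: ler_pM => //; by rewrite exprn_ge0 // ltW.
rewrite -!powRD ?(gt_eqF nR0) ?implybT //.
by rewrite (_ : 22 + 3 * k - M = - (2 * k)) // ME; ring.
Qed.
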